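(* Let $C$ be an involutive field that has a partially ordered strict subsemifield $P$ whose elements are all self-adjoint and include $a^\dagger a$ for all $a\in C$. If $P$ is suprema compatible and monotone sequentially complete, then there is an isomorphism of $C$ with $\mathbb{R}$ or $\mathbb{C}$ that maps $P$ onto $\mathbb{R}_+=\{r\in\mathbb{R}: r\ge 0\}$.
   Context: An involutive field is a (commutative) field $C$ with a field automorphism $a\mapsto a^\dagger$ satisfying $a^{\dagger\dagger}=a$; an element is self-adjoint if $a^\dagger=a$. The fields $\mathbb{R}$ and $\mathbb{C}$ are regarded as involutive fields with the trivial involution and complex conjugation, respectively, and the isomorphism is one of involutive fields. A semifield is a set with operations $+,\cdot$ and distinct elements $0,1$ such that $(S,+,0)$ and $(S,\cdot,1)$ are commutative monoids, multiplication distributes over addition, $0$ is absorbing, and every non-zero element has a multiplicative inverse. It is strict if it is not a field (equivalently, $1$ has no additive inverse). A partially ordered strict semifield is a strict semifield with a partial order $\ge$ such that: $a\ge b$ implies $a+c\ge b+c$; $a\ge b$ implies $ac\ge bc$; and $1\ge0$. A partially ordered strict subsemifield $P$ of $C$ is a subset containing $0,1$ and closed under $+$, $\cdot$ and inverses of non-zero elements, which is strict as a semifield, together with a partial order on $P$ (not assumed to come from $C$) making it a partially ordered strict semifield. A partially ordered strict semifield $S$ is monotone sequentially complete if every increasing sequence in $S$ with an upper bound has a supremum. It is suprema compatible if for every increasing sequence $(b_n)$ in $S$ such that $\sup b_n$ exists, $\sup(1+b_n)$ exists and equals $1+\sup b_n$. Suprema are taken in the order of $S$, and ''increasing'' includes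 equality. *)

(* Defs.v *)
From mathcomp Require Import all_boot all_order all_algebra.
From mathcomp Require Import classical_sets reals complex.

Set Implicit Arguments.
Unset Strict Implicit.
Unset Printing Implicit Defensive.

Import Order.TTheory GRing.Theory Num.Theory.
Local Open Scope ring_scope.
Local Open Scope classical_set_scope.

(* A subsemifield of C is a subset P : set C.  Commutativity, associativity,
   distributivity, absorption and 0 != 1 are inherited from C. *)
Record subsemifield (C : fieldType) (P : set C) : Prop := Subsemifield {
  ssf_zero : P 0;
  ssf_one : P 1;
  ssf_add : forall a b, P a -> P b -> P (a + b);
  ssf_mul : forall a b, P a -> P b -> P (a * b);
  ssf_inv : forall a, P a -> a != 0 -> P a^-1
}.

(* A semifield is a field as soon as each of its elements has an additive
   inverse in it; strictness denies this. *)
Definition strict_subsemifield (C : fieldType) (P : set C) : Prop :=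
  subsemifield P /\ ~ (forall a, P a -> exists2 b, P b & a + b = 0).

(* The order on P is a relation le on C of which only the restriction to P is
   ever used; le a b reads "b >= a".  C itself carries no order. *)
Record partial_order_on (T : Type) (P : set T) (le : T -> T -> Prop) : Prop :=
  PartialOrderOn {
  po_refl : forall a, P a -> le a a;
  po_anti : forall a b, P a -> P b -> le a b -> le b a -> a = b;
  po_trans : forall a b c, P a -> P b -> P c -> le a b -> le b c -> le a c
}.

Record po_strict_subsemifield (C : fieldType) (P : set C)
    (le : C -> C -> Prop) : Prop := PoStrictSubsemifield {
  pos_strict : strict_subsemifield P;
  pos_order : partial_order_on P le;
  pos_add : forall a b c, P a -> P b -> P c -> le b a -> le (b + c) (a + c);
  pos_mul : forall a b c, P a -> P b -> P c -> le b a -> le (b * c) (a * c);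
  pos_le01 : le 0 1
}.

Definition increasing_in (T : Type) (P : set T) (le : T -> T -> Prop)
    (b : nat -> T) : Prop :=
  (forall n, P (b n)) /\ (forall n, le (b n) (b n.+1)).

Definition upper_bound_in (T : Type) (P : set T) (le : T -> T -> Prop)
    (b : nat -> T) (u : T) : Prop :=
  P u /\ (forall n, le (b n) u).

Definition supremum_in (T : Type) (P : set T) (le : T -> T -> Prop)
    (b : nat -> T) (s : T) : Prop :=
  upper_bound_in P le b s /\ (forall u, upper_bound_in P le b u -> le s u).

Definition monotone_sequentially_complete (T : Type) (P : set T)
    (le : T -> T -> Prop) : Prop :=
  forall b, increasing_in P le b ->
    (exists u, upper_bound_in P le b u) -> exists s, supremum_in P le b s.

Definition suprema_compatible (C : fieldType) (P : set C)
    (le : C -> C -> Prop) : Prop :=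
  forall b s, increasing_in P le b -> supremum_in P le b s ->
    supremum_in P le (fun n => 1 + b n) (1 + s).

Definition involutive_field_iso (C D : fieldType) (dagC : C -> C)
    (dagD : D -> D) (f : {rmorphism C -> D}) : Prop :=
  bijective f /\ (forall a, f (dagC a) = dagD (f a)).

(* Main.v *)
Require Import Defs.
From HB Require Import structures.
From mathcomp Require Import all_boot all_order all_algebra.
From mathcomp Require Import boolp classical_sets reals complex ring.

(** The order of [P] and the field structure of [C] meet in one fact: every
    element of [P] has a square root in [P] ([exists_sqrt]).  Since
    multiplication by a non-zero element of [P] is an order automorphism,
    compatibility of suprema with [1 + _] spreads to all of the arithmetic of
    [P] ([supremum_scale], [supremum_mul]), so the supremum of a bounded
    increasing iteration is a fixed point.  The iteration is Heron's method,
    written for the inverse of the root so that it increases.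

    Square roots make everything total.  If [x] is self-adjoint, then
    [x ^+ 2 = dag x * x] lies in [P], hence equals [e ^+ 2] with [e] in [P],
    and in a field this forces [x = e] or [x = - e].  So the self-adjoint
    elements form a field that is totally ordered by [P], and on [P] the given
    order is the one of this field.  That field is Archimedean: a
    supremum [s] of the natural numbers would satisfy [1 + s = s]
    ([nat_unbounded]).

    A self-adjoint [x] is then determined by the rationals below it, and
    their supremum in [R] is the image [cut x] of [x].  This map preserves
    sums and products, and it is onto because an increasing sequence of
    rationals tending to a given real has a supremum in [P].

    If [dag] is trivial, [cut] is the isomorphism onto [R].  Otherwise there is
    [j != 0] with [dag j = - j]; dividing it by a square root of [dag j * j]
    gives [i] with [dag i = - i] and [i ^+ 2 = -1], and [C] splits into
    self-adjoint real and imaginary parts, to which [cut] applies. *)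

Set Implicit Arguments.
Unset Strict Implicit.
Unset Printing Implicit Defensive.

Import Order.TTheory GRing.Theory Num.Theory.
Local Open Scope ring_scope.
Local Open Scope classical_set_scope.

(** * Strict subsemifields of a field *)

Section StrictSubsemifield.
Variables (C : fieldType) (P : set C).
Hypothesis sP : strict_subsemifield P.
Let P0 := ssf_zero sP.1.
Let P1 := ssf_one sP.1.
Let PD := ssf_add sP.1.
Let PM := ssf_mul sP.1.
Let PV := ssf_inv sP.1.

(** A non-zero [a] with [a] and [- a] in [P] would put [- a / a = -1] in [P],
    and then every element of [P] would have its opposite in [P]. *)
Lemma strict_opp_eq0 a : P a -> P (- a) -> a = 0.
Proof.
move=> Pa Pna; apply/eqP/negP => /negP a0; apply: sP.2 => b Pb.
by exists (b * (- a / a)); [do 2?apply: PM => //; apply: PV | field].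
Qed.

Lemma subsemifield_nat n : P n%:R.
Proof. by elim: n => [|n IHn]; rewrite ?mulrS//; apply: PD. Qed.

Lemma strict_natS_neq0 n : n.+1%:R != 0 :> C.
Proof.
apply/negP; rewrite mulrS addrC addr_eq0 => /eqP nE; move: (oner_neq0 C).
rewrite (strict_opp_eq0 P1) ?eqxx// -nE; exact: subsemifield_nat.
Qed.

Lemma strict_addr_neq0 a b : P a -> P b -> a != 0 -> a + b != 0.
Proof.
move=> Pa Pb a0; apply/negP; rewrite addrC addr_eq0 => /eqP bE.
by move: a0; rewrite (strict_opp_eq0 Pa) ?eqxx// -bE.
Qed.

(** Strictness gives [C] characteristic zero, so denominators are invertible
    in [C] and [ratr] is a morphism although [C] has no order. *)
Lemma strict_rat_morphism : exists iota : {rmorphism rat -> C}, True.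
Proof.
have intr_neq0 (a : int) : a != 0 -> a%:~R != 0 :> C.
  case: a => [[|n]|n] // _; first exact: strict_natS_neq0.
  by rewrite NegzE rmorphN oppr_eq0 strict_natS_neq0.
have ratr_frac (a b : int) : b != 0 -> ratr (a%:~R / b%:~R) = a%:~R / b%:~R :> C.
  move=> b0; have [d0 bq0] : denq (a%:~R / b%:~R) != 0 /\ b%:~R != 0 :> rat.
    by rewrite denq_neq0 intr_eq0.
  apply/eqP; rewrite eqr_div ?intr_neq0// -!rmorphM /=; apply/eqP.
  congr _%:~R; apply: (@intr_inj rat); rewrite !rmorphM /= numqE mulrAC.
  by rewrite divfK.
have ratB : zmod_morphism (@ratr C).
  move=> q r.
  have -> : q - r = (numq q * denq r - numq r * denq q)%:~R / (denq q * denq r)%:~R.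
    rewrite -{1}[q]divq_num_den -{1}[r]divq_num_den rmorphB !rmorphM /=.
    by field; rewrite !intr_eq0 !denq_neq0.
  rewrite ratr_frac ?mulf_neq0 ?denq_neq0// /ratr.
  by rewrite rmorphB !rmorphM /=; field; rewrite !intr_neq0 ?denq_neq0.
have ratM : monoid_morphism (@ratr C).
  split=> [|q r]; first by rewrite -[1]/(1%:~R) ratr_int.
  rewrite -[q]divq_num_den -[r]divq_num_den mulf_div -!rmorphM /=.
  by rewrite !ratr_frac ?mulf_neq0 ?denq_neq0// mulf_div !rmorphM.
pose aM := GRing.isZmodMorphism.Build rat C _ ratB.
pose mM := GRing.isMonoidMorphism.Build rat C _ ratM.
pose iota : {rmorphism rat -> C} := HB.pack (@ratr C) aM mM.
by exists iota.
Qed.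

End StrictSubsemifield.

(** * Suprema and square roots *)

Section Suprema.
Variables (C : fieldType) (P : set C) (le : C -> C -> Prop).
Hypothesis hP : po_strict_subsemifield P le.
Let sP := pos_strict hP.
Let P0 := ssf_zero sP.1.
Let P1 := ssf_one sP.1.
Let PD := ssf_add sP.1.
Let PM := ssf_mul sP.1.
Let PV := ssf_inv sP.1.
Let le_refl := po_refl (pos_order hP).
Let le_anti := po_anti (pos_order hP).
Let le_trans := po_trans (pos_order hP).
Let le_addr := pos_add hP.
Let le_mulr := pos_mul hP.

(** [0 <= 1] makes every element of [P] non-negative; adding [a] to
    [0 <= b - a] gives the claim.  The converse has to wait for
    totality, since no axiom allows cancelling a summand in [le]. *)
Lemma le_of_sub a b : P a -> P b -> P (b - a) -> le a b.
Proof.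
move=> Pa Pb Pba; have := le_mulr P1 P0 Pba (pos_le01 hP).
rewrite mul0r mul1r => le0; have := le_addr Pba P0 Pa le0.
by rewrite add0r subrK.
Qed.

Lemma increasing_le b m n : increasing_in P le b -> (m <= n)%N -> le (b m) (b n).
Proof.
move=> [Pb bS]; elim: n => [|n IHn].
  by rewrite leqn0 => /eqP->; exact: le_refl.
rewrite leq_eqVlt => /predU1P[->|]; first exact: le_refl.
by rewrite ltnS => /IHn/le_trans; apply => //; apply: Pb.
Qed.

Lemma increasing_mul a b : increasing_in P le a -> increasing_in P le b ->
  increasing_in P le (fun n => a n * b n).
Proof.
move=> [Pa aS] [Pb bS]; split=> n; first exact: PM.
apply: (@le_trans _ (a n.+1 * b n)); do ?exact: PM; first exact: le_mulr.
by rewrite ![a _ * _]mulrC; apply: le_mulr.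
Qed.

Lemma supremum_uniq b s t :
  supremum_in P le b s -> supremum_in P le b t -> s = t.
Proof.
move=> [bs sl] [bt tl]; apply: le_anti;
  [exact: bs.1 | exact: bt.1 | exact: sl | exact: tl].
Qed.

Lemma supremum_shift b s : increasing_in P le b ->
  supremum_in P le b s -> supremum_in P le (fun n => b n.+1) s.
Proof.
move=> [Pb bS] [[Ps bs] sl]; split; first by split.
move=> u [Pu bu]; apply: sl; split=> // n.
exact: (@le_trans _ (b n.+1)).
Qed.

(** For [c != 0], multiplication by [c^-1] also preserves the order. *)
Lemma supremum_scale c b s : P c -> increasing_in P le b ->
  supremum_in P le b s -> supremum_in P le (fun n => c * b n) (c * s).
Proof.
move=> Pc [Pb bS] [[Ps bs] sl]; split.
  split=> [|n]; first exact: PM.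
  by rewrite ![c * _]mulrC; apply: le_mulr.
have [->|c0] := eqVneq c 0.
  by move=> u [Pu _]; rewrite mul0r; apply: le_of_sub; rewrite ?subr0.
move=> u [Pu bu].
have : le s (c^-1 * u).
  apply: sl; split=> [|n]; first by apply: PM => //; apply: PV.
  have := le_mulr Pu (PM Pc (Pb n)) (PV Pc c0) (bu n).
  by rewrite mulrAC divff// mul1r mulrC.
move=> /(le_mulr (PM (PV Pc c0) Pu) Ps Pc).
by rewrite mulrAC mulVf// mul1r mulrC.
Qed.

(** By monotonicity the products [a n * b n] have the same upper bounds as all
    the products [a n * b m], whose supremum can be taken one index at a time. *)
Lemma supremum_mul a b s t : increasing_in P le a -> increasing_in P le b ->
  supremum_in P le a s -> supremum_in P le b t ->
  supremum_in P le (fun n => a n * b n) (s * t).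
Proof.
move=> ia ib sa sb; have [[Ps aub] sl] := sa; have [[Pt bub] tl] := sb.
have [Pa aS] := ia; have [Pb bS] := ib; split.
  split=> [|n]; first exact: PM.
  apply: (@le_trans _ (s * b n)); do ?exact: PM; first exact: le_mulr.
  by rewrite ![s * _]mulrC; apply: le_mulr.
move=> u [Pu abu].
have leu n : le (a n * t) u.
  apply: (supremum_scale (Pa n) ib sb).2; split=> // m.
  have [mn|/ltnW mn] := leqP m n.
  - apply: (@le_trans _ (a n * b n)); rewrite //; do ?exact: PM.
    by rewrite ![a n * _]mulrC; apply: le_mulr => //; apply: increasing_le.
  - apply: (@le_trans _ (a m * b m)); rewrite //; do ?exact: PM.
    by apply: le_mulr => //; apply: increasing_le.
rewrite mulrC; apply: (supremum_scale Pt ia sa).2; split=> // n.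
by rewrite mulrC.
Qed.

Hypothesis hsup : suprema_compatible P le.
Hypothesis hmon : monotone_sequentially_complete P le.

(** Compatibility of suprema would force [1 + s = s] for the supremum [s] of
    the natural numbers, and [C] is a field. *)
Lemma nat_unbounded u : ~ upper_bound_in P le (fun n => n%:R) u.
Proof.
move=> nu; have inat : increasing_in P le (fun n => n%:R).
  split=> n; first exact: subsemifield_nat.
  apply: le_of_sub; do ?exact: subsemifield_nat.
  by rewrite mulrSr addrAC subrr add0r.
have [s ss] : exists s, supremum_in P le (fun n => n%:R) s.
  by apply: hmon => //; exists u.
have := hsup inat ss; rewrite (_ : (fun _ => _) = (fun n => n.+1%:R)).
  move=> s1; have := supremum_uniq s1 (supremum_shift inat ss).
  by move/eqP; rewrite -subr_eq0 addrK oner_eq0.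
by apply: funext => n; rewrite mulrS.
Qed.

Hypothesis sqP : forall a b, P a -> P b -> P ((a - b) ^+ 2).

(** Heron's iteration [y |-> (y + q / y) / 2] becomes
    [z |-> 2 * z / (1 + q * z ^+ 2)] for [z = y^-1].  Starting below
    [1 / sqrt q] it increases and stays below, as seen from
    [1 - q * z' ^+ 2 = ((1 - q * z ^+ 2) / (1 + q * z ^+ 2)) ^+ 2], where [z']
    follows [z]: this is where squares of differences need to be in [P].
    All inequalities are memberships of differences in [P]. *)
Lemma exists_sqrt q : P q -> exists2 e, P e & e ^+ 2 = q.
Proof.
have [->|q0] := eqVneq q 0; first by exists 0; rewrite ?expr0n.
move=> Pq; have [z zE0 zES] : exists2 z : nat -> C, z 0%N = (1 + q)^-1 &
    forall n, z n.+1 = 2 * z n / (1 + q * z n ^+ 2)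
  by exists (fun n => iter n (fun x => 2 * x / (1 + q * x ^+ 2)) (1 + q)^-1).
have d0 a : P a -> 1 + a != 0.
  by move=> Pa; exact: strict_addr_neq0 sP _ _ P1 Pa (oner_neq0 _).
have P2 : P 2 by apply: PD.
have Psq a : P a -> P (a ^+ 2) by move=> Pa; rewrite expr2; apply: PM.
have two0 : 2 != 0 :> C := d0 _ P1.
have [Pz z0] : (forall n, P (z n)) /\ (forall n, z n != 0).
  suff H n : P (z n) /\ z n != 0 by split=> n; case: (H n).
  elim: n => [|n [Pz z0]]; rewrite (zE0, zES).
    rewrite invr_neq0 ?d0//; split=> //.
    by apply: PV (d0 _ Pq); apply: PD.
  have Pqz : P (q * z n ^+ 2) by apply: PM => //; apply: Psq.
  split; last by rewrite !mulf_neq0 ?invr_neq0// d0.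
  by apply: PM; [apply: PM | apply: PV (d0 _ Pqz); apply: PD].
have Pqz n : P (q * z n ^+ 2) by apply: PM => //; apply: Psq.
have small n : P (1 - q * z n ^+ 2).
  case: n => [|n]; rewrite (zE0, zES).
    rewrite (_ : _ - _ = (1 + q + q ^+ 2) * ((1 + q)^-1) ^+ 2).
      2: by field; exact: d0.
    apply: PM; first by do ?apply: PD => //; apply: Psq.
    by apply/Psq/PV/d0 => //; apply: PD.
  rewrite (_ : _ - _ = (1 - q * z n ^+ 2) ^+ 2 * ((1 + q * z n ^+ 2)^-1) ^+ 2).
    2: by field; exact: d0.
  by apply: PM; [apply: sqP | apply/Psq/PV/d0 => //; apply: PD].
have zS n : P (z n.+1 - z n).
  rewrite zES (_ : _ - _ = z n * (1 - q * z n ^+ 2) * (1 + q * z n ^+ 2)^-1).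
    2: by field; exact: d0.
  by apply: PM; [apply: PM | apply/PV/d0 => //; apply: PD].
have iz : increasing_in P le z by split=> // n; exact: le_of_sub.
have Pz0 n : P (z n - z 0%N).
  elim: n => [|n IHn]; first by rewrite subrr.
  by rewrite -(subrK (z n) (z n.+1)) -addrA; apply: PD.
(* From q * z n * z 0 <= q * z n ^+ 2 <= 1. *)
have [s ss] : exists s, supremum_in P le z s.
  apply: hmon => //; exists (q * z 0%N)^-1.
  have Pb : P (q * z 0%N)^-1 by apply: PV; [apply: PM|rewrite mulf_neq0].
  split=> // n; apply: le_of_sub => //.
  rewrite (_ : _ - _ =
      (q * z 0%N)^-1 * ((1 - q * z n ^+ 2) + q * z n * (z n - z 0%N))).
    by apply: PM => //; apply: PD => //; apply: PM => //; apply: PM.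
  by field; rewrite q0 z0.
have [[Ps sub] _] := ss.
have s0 : s != 0.
  apply/negP => /eqP sE; have := z0 0%N; rewrite (le_anti (Pz 0%N) P0) ?eqxx//.
    by rewrite -sE.
  by apply: le_of_sub; rewrite ?subr0.
have iz2 := increasing_mul iz iz.
have izq : increasing_in P le (fun n => q * (z n * z n)).
  split=> n; first by apply: PM => //; apply: PM.
  by rewrite ![q * _]mulrC; apply: le_mulr => //; do ?exact: PM; apply: iz2.2.
have izS : increasing_in P le (fun n => z n.+1).
  by split=> n; [apply: Pz | apply: iz.2].
have iq1 : increasing_in P le (fun n => 1 + q * (z n * z n)).
  split=> n; first by apply: PD => //; exact: izq.1.
  by rewrite ![1 + _]addrC; apply: le_addr => //;
    [exact: izq.1 | exact: izq.1 | exact: izq.2].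
(* Compare the suprema of both sides of z n.+1 * (1 + q * z n ^+ 2) = 2 * z n:
   the form without division has only increasing factors. *)
have sl := supremum_mul izS iq1 (supremum_shift iz ss)
  (hsup izq (supremum_scale Pq iz2 (supremum_mul iz iz ss ss))).
have sr := supremum_scale P2 iz ss.
have zE : (fun n => z n.+1 * (1 + q * (z n * z n))) = (fun n => 2 * z n).
  by apply: funext => n; rewrite -expr2 zES divfK ?d0.
rewrite zE in sl; have sE := supremum_uniq sl sr.
exists s^-1; first exact: PV.
have {}sE : q * (s * s) = 1.
  apply: (mulfI s0); apply: (addrI s); rewrite mulr1.
  by rewrite -{1}[s]mulr1 -mulrDr sE mulr_natl mulr2n.
by rewrite -[q]mulr1 exprVn -(mulfV (mulf_neq0 s0 s0)) mulrA sE mul1r expr2.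
Qed.

End Suprema.

(** * The real number of a self-adjoint element *)

Section OrderedSelfAdjoint.
Variables (R : realType) (C : fieldType) (dag : {rmorphism C -> C}) (P : set C).
Hypothesis sP : strict_subsemifield P.
Hypothesis P_total : forall x, dag x = x -> P x \/ P (- x).
Hypothesis P_sa : forall x, P x -> dag x = x.
Hypothesis P_archi : forall x, P x -> exists n : nat, P (n%:R - x).
Variable iota : {rmorphism rat -> C}.
Let P1 := ssf_one sP.1.
Let PD := ssf_add sP.1.
Let PM := ssf_mul sP.1.
Let PV := ssf_inv sP.1.

Lemma rat_ge0 q : P (iota q) <-> 0 <= q.
Proof.
suff H r : 0 <= r -> P (iota r).
  split=> [Pq|]; last exact: H.
  rewrite leNgt; apply/negP => q0; have Pnq : P (- iota q).
    by rewrite -rmorphN; apply: H; rewrite oppr_ge0 ltW.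
  have /eqP := strict_opp_eq0 sP Pq Pnq.
  by rewrite fmorph_eq0 => /eqP qE; rewrite qE ltxx in q0.
move=> r0; rewrite -[r]divq_num_den fmorph_div !rmorph_int.
have Pint (a : int) : 0 <= a -> P a%:~R.
  by case: a => // n _; exact: subsemifield_nat.
apply: PM; first by apply: Pint; rewrite numq_ge0.
apply: PV; first exact: Pint.
by rewrite -(rmorph_int iota) fmorph_eq0 intr_eq0.
Qed.

Lemma rat_sa q : dag (iota q) = iota q.
Proof.
have [/rat_ge0/P_sa//|/ltW q0] := leP 0 q.
by apply: oppr_inj; rewrite -!rmorphN /= P_sa//; apply/rat_ge0; rewrite oppr_ge0.
Qed.

Lemma rat_sub_ge0 q r : P (iota q - iota r) <-> r <= q.
Proof. by rewrite -rmorphB rat_ge0 subr_ge0. Qed.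

Lemma archi_rat x : dag x = x -> exists2 q, P (x - iota (- q)) & P (iota q - x).
Proof.
move=> /P_total; have H y : P y -> exists2 q, P (y - iota (- q)) & P (iota q - y).
  move=> Py; have [n Pn] := P_archi Py; exists n%:R; last by rewrite rmorph_nat.
  by rewrite rmorphN opprK rmorph_nat; apply: PD => //; exact: subsemifield_nat.
move=> [/H//|/H[q q1 q2]]; exists q.
  by move: q2; rewrite rmorphN !opprK addrC.
by move: q1; rewrite rmorphN opprK addrC.
Qed.

Definition cut x : R := sup [set ratr q | q in [set q | P (x - iota q)]].

Lemma cut_lb x q : dag x = x -> P (x - iota q) -> ratr q <= cut x.
Proof.
move=> /archi_rat[b _ xb] qx; apply: ub_le_sup; last by exists q.
exists (ratr b) => _ [r /= rx <-]; rewrite ler_rat; apply/rat_sub_ge0.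
by rewrite -(subrK x (iota b)) -addrA; apply: PD.
Qed.

Lemma cut_ub x q : dag x = x -> P (iota q - x) -> cut x <= ratr q.
Proof.
move=> /archi_rat[b bx _] qx; apply: ge_sup; first by exists (ratr (- b)), (- b).
move=> _ [r /= rx <-]; rewrite ler_rat; apply/rat_sub_ge0.
by rewrite -(subrK x (iota q)) -addrA; apply: PD.
Qed.

(** A real strictly between [y] and [cut x] could be taken rational, and a
    rational is comparable to [x]. *)
Lemma cut_uniq x y : dag x = x ->
  (forall q, P (x - iota q) -> ratr q <= y) ->
  (forall q, P (iota q - x) -> y <= ratr q) -> cut x = y.
Proof.
move=> sx lb ub; have tot q : P (x - iota q) \/ P (iota q - x).
  rewrite -[_ - x]opprB; apply: P_total.
  by rewrite rmorphB /= sx rat_sa.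
apply/eqP; rewrite eq_le; apply/andP; split; rewrite leNgt; apply/negP.
  move=> /rat_in_itvoo[q]; rewrite in_itv /= => /andP[yq qx].
  case: (tot q) => [/lb|/(cut_ub sx)]; first by rewrite leNgt yq.
  by rewrite leNgt qx.
move=> /rat_in_itvoo[q]; rewrite in_itv /= => /andP[yq qx].
case: (tot q) => [/(cut_lb sx)|/ub]; last by rewrite leNgt qx.
by rewrite leNgt yq.
Qed.

Lemma cut_rat q : cut (iota q) = ratr q.
Proof.
by apply: cut_uniq => [|r /rat_sub_ge0|r /rat_sub_ge0]; rewrite ?rat_sa// ler_rat.
Qed.

Lemma cut0 : cut 0 = 0. Proof. by rewrite -(rmorph0 iota) cut_rat rmorph0. Qed.

Lemma cut1 : cut 1 = 1. Proof. by rewrite -(rmorph1 iota) cut_rat rmorph1. Qed.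

Lemma cut_ge0 x : P x -> 0 <= cut x.
Proof.
move=> Px; rewrite -(rmorph0 (ratr : {rmorphism rat -> R})).
by apply: cut_lb; [exact: P_sa | rewrite rmorph0 subr0].
Qed.

Lemma cutN x : dag x = x -> cut (- x) = - cut x.
Proof.
move=> sx; apply: cut_uniq => [|q qx|q qx]; first by rewrite rmorphN /= sx.
  rewrite lerNr -rmorphN; apply: cut_ub => //.
  by rewrite rmorphN addrC.
rewrite lerNl -rmorphN; apply: cut_lb => //.
by rewrite rmorphN opprK addrC -[x]opprK.
Qed.

(** If [q > cut x + cut y], then [q > r + s] for rationals [r > cut x] and
    [s > cut y], which lie above [x] and [y]. *)
Lemma cut_superadd x y q : dag x = x -> dag y = y ->
  P (x + y - iota q) -> ratr q <= cut x + cut y.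
Proof.
move=> sx sy qxy; rewrite leNgt; apply/negP.
rewrite -ltrBrDr => /rat_in_itvoo[r]; rewrite in_itv /= => /andP[xr].
rewrite ltrBrDr addrC -ltrBrDr -rmorphB => /rat_in_itvoo[s].
rewrite in_itv /= => /andP[ys]; rewrite ltr_rat => sqr.
have Px : P (iota r - x).
  have /P_total[Pxr|] : dag (x - iota r) = x - iota r.
  - by rewrite rmorphB /= sx rat_sa.
  - by have := cut_lb sx Pxr; rewrite leNgt xr.
  - by rewrite opprB.
have Py : P (iota s - y).
  have /P_total[Pys|] : dag (y - iota s) = y - iota s.
  - by rewrite rmorphB /= sy rat_sa.
  - by have := cut_lb sy Pys; rewrite leNgt ys.
  - by rewrite opprB.
have : P (iota (r + s) - iota q).
  rewrite rmorphD (_ : _ - _ = (iota r - x) + (iota s - y) + (x + y - iota q)).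
    2: by ring.
  by apply: PD => //; apply: PD.
by move/rat_sub_ge0; rewrite leNgt addrC -ltrBrDr sqr.
Qed.

(** [cut_superadd] at [- x] and [- y] bounds [cut x + cut y] from above. *)
Lemma cutD x y : dag x = x -> dag y = y -> cut (x + y) = cut x + cut y.
Proof.
move=> sx sy; apply: cut_uniq => [|q|q qxy]; first by rewrite rmorphD /= sx sy.
  exact: cut_superadd.
have := @cut_superadd (- x) (- y) (- q); rewrite !cutN// !rmorphN /= sx sy.
rewrite -!opprD lerN2; apply => //.
by rewrite opprB.
Qed.

(** Squaring preserves the order between non-negative rationals and [x], so
    the square root of [cut (x ^+ 2)] is in the position that defines [cut x]. *)
Lemma cut_sqr_ge0 x : P x -> cut (x ^+ 2) = cut x ^+ 2.
Proof.
move=> Px; have sx := P_sa Px; have Px2 : P (x ^+ 2) by rewrite expr2; exact: PM.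
have c0 := cut_ge0 Px2.
suff -> : cut x = Num.sqrt (cut (x ^+ 2)) by rewrite sqr_sqrtr.
apply: cut_uniq => // q qx.
- have [q0|q0] := leP q 0; first by rewrite (le_trans _ (sqrtr_ge0 _))// lerq0.
  have Pq : P (iota q) by apply/rat_ge0/ltW.
  rewrite -[ratr q]ger0_norm ?ler0q; last exact: ltW.
  rewrite -sqrtr_sqr ler_sqrt// -rmorphXn.
  apply: cut_lb; first exact: P_sa.
  rewrite rmorphXn subr_sqr; apply: PM => //; exact: PD.
have Pq : P (iota q) by rewrite -(subrK x (iota q)); apply: PD.
have q0 : 0 <= q by apply/rat_ge0.
rewrite -[ratr q]ger0_norm ?ler0q// -sqrtr_sqr ler_wsqrtr// -rmorphXn.
apply: cut_ub; first exact: P_sa.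
rewrite rmorphXn subr_sqr; apply: PM => //; exact: PD.
Qed.

Lemma cut_sqr x : dag x = x -> cut (x ^+ 2) = cut x ^+ 2.
Proof.
move=> sx; have [/cut_sqr_ge0//|/cut_sqr_ge0] := P_total sx.
by rewrite cutN// !sqrrN.
Qed.

(** Polarization of [cut_sqr]: expand [(x + y) ^+ 2]. *)
Lemma cutM x y : dag x = x -> dag y = y -> cut (x * y) = cut x * cut y.
Proof.
move=> sx sy; have sxy : dag (x * y) = x * y by rewrite rmorphM /= sx sy.
have sD a b : dag a = a -> dag b = b -> dag (a + b) = a + b.
  by move=> sa sb; rewrite rmorphD /= sa sb.
have sX a : dag a = a -> dag (a ^+ 2) = a ^+ 2 by move=> sa; rewrite rmorphXn /= sa.
have : cut ((x + y) ^+ 2) = (cut x + cut y) ^+ 2 by rewrite cut_sqr ?cutD ?sD.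
rewrite !sqrrD mulr2n !cutD ?cut_sqr ?sD ?sX// => /addIr/addrI/eqP.
by rewrite -mulr2n -subr_eq0 -mulrnBl mulrn_eq0 /= subr_eq0 => /eqP.
Qed.

Section Completeness.
Variable le : C -> C -> Prop.
Hypothesis leE : forall x y, P x -> P y -> le x y <-> P (y - x).
Hypothesis hmon : monotone_sequentially_complete P le.

(** The dyadic approximations [floor (2 ^ n * r) / 2 ^ n] increase to [r]; let
    [s] be their supremum in [P].  No rational above [r] is below [s], and
    [s] exceeds each approximation, so [cut s = r]. *)
Lemma cut_onto_ge0 r : 0 <= r -> exists2 x, P x & cut x = r.
Proof.
move=> r0; pose t n : nat := Num.truncn (2 ^+ n * r).
pose q n : rat := (t n)%:R / 2 ^+ n.
have p0 (F : numFieldType) n : 0 < 2 ^+ n :> F by rewrite exprn_gt0.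
have ratr_q n : ratr (q n) = (t n)%:R / 2 ^+ n :> R.
  by rewrite fmorph_div rmorphXn /= !ratr_nat.
have pr0 n : 0 <= 2 ^+ n * r by rewrite mulr_ge0// ltW ?p0.
have qr n : ratr (q n) <= r.
  by rewrite ratr_q ler_pdivrMr ?p0// mulrC truncn_le.
have rq n : r < ratr (q n) + (2 ^+ n)^-1.
  rewrite ratr_q -[X in _ + X]mul1r -mulrDl ltr_pdivlMr ?p0// mulrC natr1.
  exact: truncnS_gt.
have qS n : q n <= q n.+1.
  rewrite /q exprS invfM mulrA ler_pM2r ?invr_gt0 ?p0// ler_pdivlMr ?p0//.
  rewrite -natrM ler_nat truncn_ge_nat ?pr0// natrM exprS -mulrA mulrC ler_wpM2l//.
  by rewrite truncn_le.
have q0 n : 0 <= q n by rewrite divr_ge0// ltW ?p0.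
have Pq n : P (iota (q n)) by apply/rat_ge0.
have iq : increasing_in P le (iota \o q).
  by split=> n; [exact: Pq | apply/leE => //=; apply/rat_sub_ge0; exact: qS].
have ub p : r <= ratr p -> upper_bound_in P le (iota \o q) (iota p).
  move=> rp; have Pp : P (iota p) by apply/rat_ge0; rewrite -(ler0q R) (le_trans r0).
  split=> // n; apply/leE => //=; apply/rat_sub_ge0.
  by rewrite -(ler_rat R) (le_trans (qr n)).
have [s [[Ps qs] sl]] : exists s, supremum_in P le (iota \o q) s.
  apply: hmon => //; exists (iota (Num.truncn r).+1%:R); apply: ub.
  by rewrite ratr_nat ltW// truncnS_gt.
exists s => //; apply/eqP; rewrite eq_le; apply/andP.
split; rewrite leNgt; apply/negP.
  move=> /rat_in_itvoo[p]; rewrite in_itv /= => /andP[rp].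
  apply/negP; rewrite -leNgt; apply: cut_ub; first exact: P_sa.
  have ubp := ub _ (ltW rp); apply/leE => //; [exact: ubp.1|exact: sl].
move=> /ltr_add_invr[k]; apply/negP; rewrite -leNgt.
apply: (le_trans (ltW (rq k.+1))); apply: lerD.
  by apply: cut_lb; [exact: P_sa | exact/(leE (Pq _) Ps)/qs].
by rewrite lef_pV2 ?posrE ?p0 ?ltr0Sn// -(natrX R 2) ler_nat; exact/ltnW/ltn_expl.
Qed.

Lemma cut_onto r : exists2 x, dag x = x & cut x = r.
Proof.
have [/cut_onto_ge0[x Px xr]|r0] := leP 0 r; first by exists x => //; exact: P_sa.
have /cut_onto_ge0[x /P_sa sx xr] : 0 <= - r by rewrite oppr_ge0 ltW.
by exists (- x); rewrite ?rmorphN /= ?sx// cutN// xr opprK.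
Qed.

(** * The isomorphisms *)

Lemma real_iso : (forall x, dag x = x) -> exists f : {rmorphism C -> R},
  involutive_field_iso dag id f /\ f @` P = [set r | 0 <= r].
Proof.
move=> sa; have cutB : zmod_morphism cut.
  by move=> x y; rewrite cutD ?cutN ?sa.
have cut1M : monoid_morphism cut.
  by split=> [|x y]; [exact: cut1 | apply: cutM].
pose aM := GRing.isZmodMorphism.Build C R _ cutB.
pose mM := GRing.isMonoidMorphism.Build C R _ cut1M.
pose f : {rmorphism C -> R} := HB.pack cut aM mM.
exists f; split; first split.
- have /boolp.choice[g gK] : forall r, exists x, f x = r.
    by move=> r; have [x _ xr] := cut_onto r; exists x.
  by exists g => // x; apply: (fmorph_inj f); rewrite gK.
- by move=> x; rewrite sa.
- apply/seteqP; split=> [_ [x Px <-]|r /= /cut_onto_ge0[x Px xr]].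
    exact: cut_ge0.
  by exists x.
Qed.

(** Every [x] is [re x + i * im x] with self-adjoint [re x] and [im x], and these
    parts multiply like those of a complex number because [i ^+ 2 = -1]. *)
Lemma complex_iso i : involutive dag -> dag i = - i -> i ^+ 2 = -1 ->
  exists f : {rmorphism C -> complex R},
  involutive_field_iso dag (@conjc R) f /\
  f @` P = real_complex R @` [set r | 0 <= r].
Proof.
move=> dagK di i2; have two0 : 2 != 0 :> C by exact: strict_natS_neq0 sP 1.
pose re x := (x + dag x) / 2; pose im x := re (- (i * x)).
have sre x : dag (re x) = re x.
  by rewrite /re fmorph_div rmorphD /= rmorph_nat dagK addrC.
have sim x : dag (im x) = im x by exact: sre.
have imE x : im x = i * (dag x - x) / 2.
  by rewrite /im /re rmorphN rmorphM /= di; field.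
have re_sa x y : dag x = x -> dag y = y -> re (x + i * y) = x.
  by move=> sx sy; rewrite /re rmorphD rmorphM /= di sx sy; field.
have im_sa x y : dag x = x -> dag y = y -> im (x + i * y) = y.
  by move=> sx sy; rewrite imE rmorphD rmorphM /= di sx sy; field: i2.
have im_P x : P x -> im x = 0.
  by move=> /P_sa sx; rewrite imE sx subrr mulr0 mul0r.
have re_P x : P x -> re x = x by move=> /P_sa sx; rewrite /re sx; field.
pose g x : complex R := Complex (cut (re x)) (cut (im x)).
have gB : zmod_morphism g.
  move=> x y; have -> : g x - g y =
    Complex (cut (re x) - cut (re y)) (cut (im x) - cut (im y)) by [].
  have reB : re (x - y) = re x - re y by rewrite /re rmorphB /=; field.
  have imB : im (x - y) = im x - im y by rewrite !imE rmorphB /=; field.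
  by rewrite /g reB imB !cutD ?cutN ?rmorphN /= ?sre ?sim.
have gM : monoid_morphism g.
  split=> [|x y]; first by rewrite /g re_P// im_P// cut1 cut0.
  have -> : g x * g y = Complex (cut (re x) * cut (re y) - cut (im x) * cut (im y))
    (cut (re x) * cut (im y) + cut (im x) * cut (re y)) by [].
  have reM : re (x * y) = re x * re y - im x * im y.
    by rewrite !imE /re rmorphM /=; field: i2.
  have imM : im (x * y) = re x * im y + im x * re y.
    by rewrite !imE /re rmorphM /=; field: i2.
  (* Keeps the morphism lemmas from unfolding the two parts. *)
  rewrite /g reM imM; clearbody im re.
  by rewrite !cutD ?cutN ?cutM ?rmorphN ?rmorphM /= ?sre ?sim.
pose aM := GRing.isZmodMorphism.Build C (complex R) _ gB.
pose mM := GRing.isMonoidMorphism.Build C (complex R) _ gM.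
pose f : {rmorphism C -> complex R} := HB.pack g aM mM.
exists f; split; first split.
- have /boolp.choice[h hK] : forall z, exists x, f x = z.
    move=> [a b]; have [x sx xa] := cut_onto a; have [y sy yb] := cut_onto b.
    by exists (x + i * y); rewrite /f /= /g re_sa// im_sa// xa yb.
  by exists h => // x; apply: (fmorph_inj f); rewrite hK.
- move=> x; rewrite /f /= /g; congr Complex; first by rewrite /re dagK addrC.
  by rewrite -cutN ?sim// !imE dagK -opprB mulrN mulNr.
- apply/seteqP; split=> [_ [x Px <-]|_ [r /= /cut_onto_ge0[x Px xr] <-]].
    by exists (cut x); [exact: cut_ge0 | rewrite /f /= /g re_P// im_P// cut0].
  by exists x => //; rewrite /f /= /g re_P// im_P// cut0 xr.
Qed.

End Completeness.

End OrderedSelfAdjoint.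

Theorem proposition32 (R : realType) (C : fieldType)
    (dag : {rmorphism C -> C}) (dagK : involutive dag)
    (P : set C) (le : C -> C -> Prop)
    (hP : po_strict_subsemifield P le)
    (hsa : forall a : C, P a -> dag a = a)
    (hsq : forall a : C, P (dag a * a))
    (hsup : suprema_compatible P le)
    (hmon : monotone_sequentially_complete P le) :
  (exists f : {rmorphism C -> R},
     involutive_field_iso dag (fun r : R => r) f /\
     f @` P = [set r : R | 0 <= r]) \/
  (exists f : {rmorphism C -> complex R},
     involutive_field_iso dag (@conjc R) f /\
     f @` P = real_complex R @` [set r : R | 0 <= r]).
Proof.
have sP := pos_strict hP.
have [iota _] := strict_rat_morphism sP.
have sqP a : dag a = a -> P (a ^+ 2) by move=> sa; rewrite expr2 -{1}sa.
have sqrtP q : P q -> exists2 e, P e & e ^+ 2 = q.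
  apply: (exists_sqrt hP hsup hmon) => a b Pa Pb.
  by apply: sqP; rewrite rmorphB /= !hsa.
have P_total x : dag x = x -> P x \/ P (- x).
  move=> /sqP/sqrtP[e Pe /eqP]; rewrite eqf_sqr => /orP[]/eqP <-; first by left.
  by right; rewrite -?opprK.
have leE x y : P x -> P y -> le x y <-> P (y - x).
  move=> Px Py; split=> [xy|]; last exact: le_of_sub.
  have [//|Pyx] : P (y - x) \/ P (- (y - x)).
    by apply: P_total; rewrite rmorphB /= !hsa.
  have yx : le y x by apply: (le_of_sub hP) => //; rewrite -opprB.
  rewrite (po_anti (pos_order hP) Px Py xy yx) subrr; exact: ssf_zero sP.1.
have archi u : P u -> exists n : nat, P (n%:R - u).
  move=> Pu; apply: contrapT => noP; apply: (nat_unbounded hP hsup hmon (u := u)).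
  split=> // n; have Pn : P n%:R by exact: subsemifield_nat sP n.
  apply/leE => //; have [//|Pnu] : P (u - n%:R) \/ P (- (u - n%:R)).
    by apply: P_total; rewrite rmorphB /= !hsa.
  by case: noP; exists n; rewrite -opprB.
have [sa|] := pselect (forall x, dag x = x); first left.
  exact: (real_iso R sP P_total hsa archi iota leE hmon sa).
move=> /existsNP[c cc]; right.
pose j := c - dag c; have dj : dag j = - j by rewrite /j rmorphB /= dagK opprB.
have j0 : j != 0 by rewrite subr_eq0 eq_sym; apply/eqP.
have [e Pe eE] := sqrtP _ (hsq j).
have e0 : e != 0.
  apply/eqP => e0; move/eqP: eE; rewrite e0 dj expr0n eq_sym.
  by rewrite mulf_eq0 oppr_eq0 (negPf j0).
apply: (complex_iso R sP P_total hsa archi iota leE hmon dagK (i := j / e)).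
  by rewrite fmorph_div /= dj hsa// mulNr.
by rewrite expr_div_n eE dj mulNr invrN mulrN -expr2 divff ?expf_neq0.
Qed.
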